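(* Let $E$ be a non-zero Banach space, let $\mathscr{L}$ be a closed left ideal of $\mathscr{B}(E)$, and suppose that $E$ is reflexive or $\mathscr{L}$ is finitely generated. Then exactly one of the following two alternatives holds: (i) $\mathscr{L}$ is contained in a fixed maximal left ideal; or (ii) $\mathscr{L}$ contains $\mathscr{F}(E)$.
   Context: All Banach spaces are complex. $\mathscr{B}(E)$ is the Banach algebra of all bounded linear operators on $E$, and $\mathscr{F}(E)$ is the two-sided ideal of finite-rank operators. ''Closed'' means closed in the operator norm. A left ideal $\mathscr{L}$ is finitely generated if there is a non-empty finite set $\Gamma\subseteq\mathscr{B}(E)$ such that $\mathscr{L}$ is the smallest left ideal containing $\Gamma$, that is, $\mathscr{L}=\{\sum_{T\in\Gamma}S_TT: S_T\in\mathscr{B}(E)\}$ (no closure is taken). A fixed maximal left ideal is one of the form $\mathscr{M}\!\mathscr{L}_x=\{T\in\mathscr{B}(E): Tx=0\}$ for some $x\in E\setminus\{0\}$. *)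

(* Defs.v *)
From HB Require Import structures.
From mathcomp Require Import all_boot all_order all_algebra.
From mathcomp Require Import all_classical all_reals all_analysis.
From mathcomp Require Export complex.

Set Implicit Arguments.
Unset Strict Implicit.
Unset Printing Implicit Defensive.

Import Order.TTheory GRing.Theory Num.Theory.
Import numFieldNormedType.Exports.

Local Open Scope classical_set_scope.
Local Open Scope complex_scope.
Local Open Scope ring_scope.

Section RealNorm.
Context {R : realType} {E : normedModType R[i]}.
Implicit Types x y : E.

(* The library norm `|x| takes its values in R[i]; it is nonnegative, hence
   real, and rnorm is the same number seen in R. *)
Definition rnorm x : R := complex.Re `|x|.

Lemma rnormE x : `|x| = (rnorm x)%:C.
Proof. by rewrite /rnorm RRe_real ?normr_real. Qed.

Lemma rnorm_ge0 x : 0 <= rnorm x.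
Proof. by rewrite -ler0c -rnormE. Qed.

Lemma rnormD x y : rnorm (x + y) <= rnorm x + rnorm y.
Proof. by rewrite -lecR rmorphD/= -!rnormE ler_normD. Qed.

Lemma rnorm0 : rnorm 0 = 0.
Proof. by rewrite /rnorm normr0. Qed.

Lemma rnorm0_eq0 x : rnorm x = 0 -> x = 0.
Proof. by move=> x0; apply: normr0_eq0; rewrite rnormE x0. Qed.

Lemma rnormZ (a : R[i]) x : rnorm (a *: x) = complex.Re `|a| * rnorm x.
Proof.
by rewrite {1}/rnorm normrZ rnormE; case: `|a| => u v; rewrite /= mulr0 subr0.
Qed.

End RealNorm.

Definition bounded_linear {R : realType} {E F : normedModType R[i]} :
    {pred E -> F} :=
  fun f => `[< linear f /\ exists M : R, forall x, rnorm (f x) <= M * rnorm x >].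

Record boundedOp (R : realType) (E F : normedModType R[i]) := BoundedOp {
  op_fun :> E -> F;
  op_funP : op_fun \in bounded_linear }.

Section BoundedOp.
Context {R : realType} {E F : normedModType R[i]}.
Local Notation B := (boundedOp E F).
Implicit Types T U : B.

HB.instance Definition _ := [isSub for @op_fun R E F].
HB.instance Definition _ := [Choice of B by <:].

Lemma op_linear T : linear T.
Proof. by have /asboolP[] := op_funP T. Qed.

HB.instance Definition _ T :=
  GRing.isLinear.Build R[i] E F _ (op_fun T) (op_linear T).

Lemma op_bounded T : exists M : R, forall x, rnorm (T x) <= M * rnorm x.
Proof. by have /asboolP[] := op_funP T. Qed.

Lemma bounded_linear_submod_closed : submod_closed (@bounded_linear R E F).
Proof.
split=> [|a f g /asboolP[lf [M Mf]] /asboolP[lg [N Ng]]]; apply/asboolP; split.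
- by move=> a x y; rewrite (_ : 0 = cst 0)// !cstE scaler0 addr0.
- by exists 0 => x; rewrite rnorm0 mul0r.
- move=> b x y; rewrite !fctE lf lg !scalerDr !scalerA [b * a]mulrC.
  by rewrite addrACA.
- exists (complex.Re `|a| * M + N) => x.
  rewrite (le_trans (rnormD _ _))// mulrDl lerD// rnormZ -mulrA.
  by rewrite ler_wpM2l// -ler0c RRe_real ?normr_real.
Qed.

HB.instance Definition _ := GRing.isSubmodClosed.Build R[i] (E -> F)
  bounded_linear bounded_linear_submod_closed.
HB.instance Definition _ := [SubChoice_isSubLmodule of B by <:].

Definition opnorm T : R := sup [set rnorm (T x) | x in [set x | rnorm x <= 1]].

Lemma opnorm_has_sup T :
  has_sup [set rnorm (T x) | x in [set x | rnorm x <= 1]].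
Proof.
split; first by exists (rnorm (T 0)), 0 => //=; rewrite rnorm0.
have [M MT] := op_bounded T; exists (Num.max M 0) => _ [x /= x1 <-].
rewrite (le_trans (MT x))// (@le_trans _ _ (Num.max M 0 * rnorm x))//.
  by rewrite ler_wpM2r ?rnorm_ge0// le_max lexx.
by rewrite ler_piMr// le_max lexx orbT.
Qed.

Lemma opnorm_ge0 T : 0 <= opnorm T.
Proof.
apply: le_trans (ub_le_sup (opnorm_has_sup T).2 _); last first.
  by exists 0 => //=; rewrite rnorm0.
exact: rnorm_ge0.
Qed.

Lemma opnorm_bound T x : rnorm (T x) <= opnorm T * rnorm x.
Proof.
have [x0|x0] := eqVneq (rnorm x) 0.
  by rewrite x0 mulr0 (rnorm0_eq0 x0) linear0 rnorm0.
have x_gt0 : 0 < rnorm x by rewrite lt_neqAle eq_sym x0 rnorm_ge0.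
have rZ (G : normedModType R[i]) (y : G) :
    rnorm ((rnorm x)^-1%:C *: y) = (rnorm x)^-1 * rnorm y.
  by rewrite rnormZ ger0_norm// ?ler0c ?invr_ge0 ?rnorm_ge0.
rewrite -ler_pdivrMr// mulrC -rZ -linearZ.
apply: (ub_le_sup (opnorm_has_sup T).2).
by exists ((rnorm x)^-1%:C *: x) => //=; rewrite rZ mulVf.
Qed.

Lemma opnorm_le T (M : R) : 0 <= M ->
  (forall x, rnorm (T x) <= M * rnorm x) -> opnorm T <= M.
Proof.
move=> M0 MT; apply: ge_sup; first exact: (opnorm_has_sup T).1.
by move=> _ [x /= x1 <-]; rewrite (le_trans (MT x))// ler_piMr.
Qed.

Lemma opnormD T U : (opnorm (T + U))%:C <= (opnorm T)%:C + (opnorm U)%:C.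
Proof.
rewrite -rmorphD lecR; apply: opnorm_le => [|x].
  by rewrite addr_ge0 ?opnorm_ge0.
by rewrite (le_trans (rnormD _ _))// mulrDl lerD// opnorm_bound.
Qed.

Lemma opnormZ_le (a : R[i]) T :
  opnorm (a *: T) <= complex.Re `|a| * opnorm T.
Proof.
have a0 : 0 <= complex.Re `|a| by rewrite -ler0c RRe_real ?normr_real.
apply: opnorm_le => [|x]; first by rewrite mulr_ge0 ?opnorm_ge0.
by rewrite rnormZ -mulrA ler_wpM2l// opnorm_bound.
Qed.

Lemma opnormZ (a : R[i]) T : (opnorm (a *: T))%:C = `|a| * (opnorm T)%:C.
Proof.
have aE (b : R[i]) : `|b| = (complex.Re `|b|)%:C by rewrite RRe_real ?normr_real.
rewrite aE -rmorphM; congr (_%:C); apply/le_anti/andP.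
split; first exact: opnormZ_le.
have [->|a0] := eqVneq a 0; first by rewrite normr0 mul0r opnorm_ge0.
have na0 : 0 < complex.Re `|a| by rewrite -ltcR -aE normr_gt0.
rewrite mulrC -ler_pdivlMr// mulrC -[in leLHS](scalerK a0 T).
rewrite (le_trans (opnormZ_le _ _))// normfV {1}aE.
by rewrite -fmorphV.
Qed.

Lemma opnorm0_eq0 T : (opnorm T)%:C = 0 -> T = 0.
Proof.
move=> /(@complexI R) T0; apply/val_inj/funext => x /=; apply: rnorm0_eq0.
by apply/le_anti; rewrite rnorm_ge0 (le_trans (opnorm_bound T x))// T0 mul0r.
Qed.

(* The norm, hence the topology, of [boundedOp E F] is the operator norm. *)
HB.instance Definition _ := Lmodule_isNormed.Build R[i] B
  opnormD opnormZ opnorm0_eq0.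

End BoundedOp.

Section OperatorAlgebra.
Context {R : realType} {E : normedModType R[i]}.
Local Notation B := (boundedOp E E).
Implicit Types S T U : B.

Lemma id_bounded_linear : (@idfun E) \in bounded_linear.
Proof. by apply/asboolP; split=> //; exists 1 => x; rewrite mul1r. Qed.

Lemma comp_bounded_linear S T : (S \o T) \in bounded_linear.
Proof.
apply/asboolP; split=> [a x y|]; first by rewrite /= !linearP.
exists (opnorm S * opnorm T) => x.
rewrite (le_trans (opnorm_bound _ _))// -mulrA.
by rewrite ler_wpM2l ?opnorm_ge0// opnorm_bound.
Qed.

Definition id_op : B := BoundedOp id_bounded_linear.
Definition comp_op S T : B := BoundedOp (comp_bounded_linear S T).

Lemma comp_opA : associative comp_op.
Proof. by move=> S T U; apply/val_inj. Qed.

Lemma comp_id_op : left_id id_op comp_op.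
Proof. by move=> T; apply/val_inj. Qed.

Lemma comp_op_id : right_id id_op comp_op.
Proof. by move=> T; apply/val_inj. Qed.

Lemma comp_opDl : left_distributive comp_op +%R.
Proof. by move=> S T U; apply/val_inj. Qed.

Lemma comp_opDr : right_distributive comp_op +%R.
Proof. by move=> S T U; apply/val_inj/funext => x; rewrite /= linearD. Qed.

(* The ring is trivial when E = 0, whence the possibly-zero ring structure. *)
HB.instance Definition _ := GRing.Zmodule_isPzRing.Build B
  comp_opA comp_id_op comp_op_id comp_opDl comp_opDr.

End OperatorAlgebra.

Section Dual.
Context {R : realType}.

Definition dual (E : normedModType R[i]) : normedModType R[i] :=
  boundedOp E R[i]^o.

Section Evaluation.
Variables (E : normedModType R[i]) (x : E).

Definition eval_at (f : dual E) : R[i]^o := op_fun f x.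

Lemma eval_at_bounded_linear : eval_at \in bounded_linear.
Proof.
apply/asboolP; split=> //; exists (rnorm x) => f.
by rewrite mulrC; exact: opnorm_bound.
Qed.

Definition bidual_embedding : dual (dual E) := BoundedOp eval_at_bounded_linear.

End Evaluation.

Definition reflexive_space (E : normedModType R[i]) :=
  forall phi : dual (dual E), exists x : E, bidual_embedding x = phi.

End Dual.

Section LeftIdeals.
Context {A : pzRingType}.
Implicit Types L : set A.

(* Not necessarily proper.  If A is a unital algebra over C, such an L is
   automatically stable under scalars: c *: t = (c *: 1) * t. *)
Definition left_ideal L :=
  [/\ L 0, forall s t, L s -> L t -> L (s + t) & forall a t, L t -> L (a * t)].

Definition fg_left_ideal L :=
  exists G : set A, [/\ finite_set G, G !=set0 & L = smallest left_ideal G].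

Lemma smallest_left_idealE (G : set A) : finite_set G ->
  smallest left_ideal G = [set \sum_(t \in G) s t * t | s in [set: A -> A]].
Proof.
move=> finG; apply/seteqP; split.
- apply: smallest_sub.
  + split.
    * by exists (fun=> 0) => //; rewrite fsbig1// => t _; rewrite mul0r.
    * move=> _ _ [s _ <-] [s' _ <-]; exists (s \+ s') => //.
      by rewrite -fsbig_split//=; apply: eq_fsbigr => t _; rewrite mulrDl.
    * move=> a _ [s _ <-]; exists (fun t => a * s t) => //.
      rewrite !fsbig_finite//= big_distrr/=.
      by apply: eq_bigr => t _; rewrite mulrA.
  + move=> t Gt; exists (fun u => (u == t)%:R) => //.
    rewrite (fsbigD1 t)//= eqxx mul1r fsbig1 ?addr0// => u [_ /= /eqP ut].
    by rewrite (negbTE ut) mul0r.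
- move=> _ [s _ <-] L [[L0 LD LM] GL]; rewrite fsbig_finite//=.
  rewrite big_seq; elim/big_ind : _ => // t.
  by rewrite in_fset_set// inE => /GL /LM.
Qed.

End LeftIdeals.

Definition exactly_one (P Q : Prop) := (P \/ Q) /\ ~ (P /\ Q).

Section OperatorIdeals.
Context {R : realType} {E : normedModType R[i]}.

Definition finite_rank : set (boundedOp E E) :=
  [set T | exists n (e : 'I_n -> E),
    range T = [set \sum_(i < n) c i *: e i | c in [set: 'I_n -> R[i]]]].

Definition fixed_left_ideal (x : E) : set (boundedOp E E) := [set T | T x = 0].

Definition fixed_maximal_left_ideal (M : set (boundedOp E E)) :=
  exists2 x : E, x != 0 & M = fixed_left_ideal x.

End OperatorIdeals.

(* Main.v *)
Require Import Defs.
From HB Require Import structures.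
From mathcomp Require Import all_boot all_order all_algebra.
From mathcomp Require Import all_classical all_reals all_analysis.
From mathcomp Require Import ring lra.

Set Implicit Arguments.
Unset Strict Implicit.
Unset Printing Implicit Defensive.

Import Order.TTheory GRing.Theory Num.Theory.
Import numFieldNormedType.Exports.
Import Normc.

Local Open Scope classical_set_scope.
Local Open Scope complex_scope.
Local Open Scope ring_scope.

(** Suppose that L annihilates no nonzero vector, that is, L lies in no fixed
    maximal left ideal. The point is to put every rank-one operator
    g(.) y into L: finite-rank operators are sums of these
    ([finite_rank_sub]), and L is a left ideal. The two alternatives exclude
    each other because, by Hahn-Banach, some rank-one operator does not kill a
    given x <> 0. Fix y; then f o T lies in K = {g | g(.) y in L} for T in L and
    every functional f, and K is a closed subspace of the dual.

    If E is reflexive and K is not the whole dual, a nonzero functional on the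
    dual vanishes on K; it is the evaluation at some x, so f(T x) = 0 for all f
    and all T in L, whence x = 0, a contradiction ([reflexive_rank_one]).

    If L is generated by a finite set s, let q(u) = \sum_(t in s) |t u|. By
    Hahn-Banach applied to the map u |-> (t u)_t, the functionals dominated by
    a multiple of q are the sums of the f_t o t, so their rank-one operators
    are in L ([dominated_rank_one]); it remains to bound the norm of E by a
    multiple of q ([joint_norm_bounded_below]). This is a closed range theorem,
    proved in three steps.
    - Every T in L satisfies |T u| <= M q(u) with M depending on T. As L is
      closed in the complete space of operators, uniform boundedness allows
      M = C |T| with a single C ([uniform_boundedness]).
    - For N >= 0, the seminorm p_N(u) = inf_x (|x| + N q(u - x)) is at most
      both |u| and N q(u). A functional of absolute value at most p_N that
      attains p_N(u) at u is of norm at most 1 and gives an element of L, so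
      the first step yields p_N(u) <= C q(u) for all N ([infconv_bounded]).
    - For N large this provides x with |x| <= (C + 1) q(u) and
      q(u - x) <= q(u) / 3. Iterating and using that E is complete, u is a
      convergent sum of such x, hence |u| <= 3/2 (C + 1) q(u). *)

(** * The Hahn-Banach theorem *)

Section RealHahnBanach.
Context {R : realType} {V : lmodType R}.
Variable p : V -> R.
Hypothesis pD : forall v w, p (v + w) <= p v + p w.
Hypothesis pZ : forall t v, 0 < t -> p (t *: v) = t * p v.

(** Functionals are handled as graphs: a linear relation below p is
    automatically functional, since p vanishes at 0. *)
Definition dominated_subspace (G : set (V * R)) :=
  (forall t v w r s, G (v, r) -> G (w, s) -> G (t *: v + w, t * r + s)) /\
  (forall v r, G (v, r) -> r <= p v).

(** The value r at the new vector v must separate the numbers s - p (w - v)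
    from the numbers p (w + v) - s, for (w, s) in G; their supremum does. *)
Lemma dominated_subspace_extend (G : set (V * R)) (v : V) :
  dominated_subspace G -> G (0, 0) ->
  exists r, dominated_subspace
    [set x | exists w s t, G (w, s) /\ x = (w + t *: v, s + t * r)].
Proof.
move=> [Glin Gp] G0.
have GZ t w s : G (w, s) -> G (t *: w, t * s).
  by move=> Gw; have := Glin t _ _ _ _ Gw G0; rewrite !addr0.
pose lower := [set x.2 - p (x.1 - v) | x in G].
have ub w s : G (w, s) -> ubound lower (p (w + v) - s).
  move=> Gw _ [[w' s'] /= Gw' <-].
  have := Gp _ _ (Glin 1 _ _ _ _ Gw Gw'); rewrite scale1r mul1r => le1.
  have := pD (w + v) (w' - v); rewrite addrACA subrr addr0 => le2.
  by have := le_trans le1 le2; lra.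
have lower_sup : has_sup lower.
  split; first by exists (0 - p (0 - v)), (0, 0).
  by exists (p (0 + v) - 0); exact: ub.
exists (sup lower).
have lo w s : G (w, s) -> s - sup lower <= p (w - v).
  move=> Gw; suff : s - p (w - v) <= sup lower by lra.
  by apply: (ub_le_sup lower_sup.2); exists (w, s).
have hi w s : G (w, s) -> s + sup lower <= p (w + v).
  by move=> Gw; have := ge_sup lower_sup.1 (ub _ _ Gw); lra.
split.
  move=> t _ _ _ _ [w [s [a [Gw [-> ->]]]]] [w' [s' [a' [Gw' [-> ->]]]]].
  exists (t *: w + w'), (t * s + s'), (t * a + a'); split; first exact: Glin.
  congr pair; first by rewrite scalerDr scalerDl scalerA addrACA.
  by rewrite mulrDr mulrDl mulrA addrACA.
move=> _ _ [w [s [t [Gw [-> ->]]]]].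
have [t0|t0|->] := ltgtP t 0; last by rewrite scale0r mul0r !addr0; exact: Gp.
- have nt0 : 0 < - t by rewrite oppr_gt0.
  have := lo _ _ (GZ (- t)^-1 _ _ Gw).
  rewrite -(ler_pM2l nt0) -pZ// mulrBr scalerBr scalerA !mulrA divff ?gt_eqF//.
  by rewrite scale1r mul1r scaleNr mulNr !opprK.
- have := hi _ _ (GZ t^-1 _ _ Gw).
  rewrite -(ler_pM2l t0) -pZ// mulrDr scalerDr scalerA !mulrA divff ?gt_eqF//.
  by rewrite scale1r mul1r.
Qed.

Lemma real_hahn_banach (G0 : set (V * R)) :
  dominated_subspace G0 -> G0 (0, 0) ->
  exists u : V -> R,
    [/\ forall t v w, u (t *: v + w) = t * u v + u w,
        forall v, u v <= p v & forall v r, G0 (v, r) -> u v = r].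
Proof.
move=> domG0 G00.
(* The empty set is let in because it is the union of the empty chain. *)
pose P (G : set (V * R)) :=
  dominated_subspace G /\ (G !=set0 -> G0 `<=` G).
have [F FP Ftot|G [[domG GG0] Gmax]] := @Zorn_bigcup _ P.
  split; last first.
    move=> [x [G FG Gx]]; apply: subset_trans (bigcup_sup FG).
    by apply: (FP _ FG).2; exists x.
  split=> [t v w r s [G FG Gv] [H FH Hw]|v r [G FG Gv]]; last first.
    exact: (FP _ FG).1.2 Gv.
  have [GH|HG] := Ftot _ _ FG FH.
    by exists H => //; apply: (FP _ FH).1.1 => //; exact: GH.
  by exists G => //; apply: (FP _ FG).1.1 => //; exact: HG.
have {}GG0 : G0 `<=` G.
  apply: GG0; apply/set0P/eqP => Ge; apply: (Gmax G0); last by split=> // _ x.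
  by rewrite Ge; split=> [x //|/(_ _ G00)].
have G00' := GG0 _ G00.
have total v : exists r, G (v, r).
  apply: contrapT => /forallNP nGv.
  have [r dom] := dominated_subspace_extend v domG G00'.
  apply: (Gmax _ _ (conj dom _)) => [|_].
    split=> [[w s] Gw|/(_ (v, r))].
      by exists w, s, 0; rewrite scale0r mul0r !addr0.
    move=> sub; apply: (nGv r); apply: sub; exists 0, 0, 1; split=> //.
    by rewrite scale1r mul1r !add0r.
  move=> [w s] /GG0 Gw; exists w, s, 0; rewrite scale0r mul0r !addr0.
  by split.
have p0 : p 0 = 0.
  have := pZ 0 (ltr0n R 2); rewrite scaler0 => ?; lra.
have uniq v r s : G (v, r) -> G (v, s) -> r = s.
  move=> Gr Gs; apply/le_anti/andP.
  have := domG.2 _ _ (domG.1 (-1) _ _ _ _ Gs Gr).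
  have := domG.2 _ _ (domG.1 (-1) _ _ _ _ Gr Gs).
  by rewrite scaleN1r addNr p0; split; lra.
have [u Gu] := choice total; exists u; split=> [t v w|v|v r /GG0].
- by apply: uniq (Gu _) (domG.1 _ _ _ _ _ (Gu v) (Gu w)).
- exact: domG.2 (Gu v).
- exact: uniq (Gu v).
Qed.

End RealHahnBanach.

Section RestrictionOfScalars.
Context {R : realType}.

Definition realified (V : lmodType R[i]) : Type := V.

Variable V : lmodType R[i].

HB.instance Definition _ := GRing.Zmodule.on (realified V).

Definition real_scale (t : R) (v : realified V) : realified V :=
  (t%:C : R[i]) *: (v : V).

Fact real_scaleA s t v : real_scale s (real_scale t v) = real_scale (s * t) v.
Proof. by rewrite /real_scale scalerA -rmorphM. Qed.

Fact real_scale1 : left_id 1 real_scale.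
Proof. by move=> v; rewrite /real_scale scale1r. Qed.

Fact real_scaleDr : right_distributive real_scale +%R.
Proof. by move=> t v w; rewrite /real_scale scalerDr. Qed.

Fact real_scaleDl v : {morph real_scale^~ v : s t / s + t}.
Proof. by move=> s t; rewrite /real_scale rmorphD scalerDl. Qed.

HB.instance Definition _ := GRing.Zmodule_isLmodule.Build R (realified V)
  real_scaleA real_scale1 real_scaleDr real_scaleDl.

End RestrictionOfScalars.


Section ComplexHahnBanach.
Context {R : realType}.

Lemma normc_ge0 (a : R[i]) : 0 <= normc a.
Proof. by case: a => x y; exact: sqrtr_ge0. Qed.

Lemma normc_gt0 (a : R[i]) : (0 < normc a) = (a != 0).
Proof.
rewrite lt_neqAle normc_ge0 andbT eq_sym; congr negb.
by apply/eqP/eqP => [/eq0_normc//|->]; exact: normc0.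
Qed.

Lemma normc_real (t : R) : 0 <= t -> normc t%:C = t.
Proof. by move=> t0; rewrite /= expr0n addr0 sqrtr_sqr ger0_norm. Qed.

Lemma Re_le_normc (a : R[i]) : complex.Re a <= normc a.
Proof.
by apply: le_trans (ler_norm _) _; rewrite -lecR; exact: normc_ge_Re.
Qed.

(** Rotating a complex number onto its modulus is what turns a bound on the
    real parts of a functional into a bound on its absolute values. *)
Lemma normc_rotate (a : R[i]) :
  exists2 b : R[i], normc b = 1 & b * a = (normc a)%:C.
Proof.
have [->|a0] := eqVneq a 0; first by exists 1; rewrite ?normc1// mulr0 normc0.
exists ((normc a)%:C / a); last by rewrite divfK.
by rewrite normcM normcV normc_real ?normc_ge0// divff// gt_eqF ?normc_gt0.
Qed.

Context {V : lmodType R[i]}.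

Definition seminorm (p : V -> R) :=
  (forall v w, p (v + w) <= p v + p w) /\
  (forall a v, p (a *: v) <= normc a * p v).

Lemma seminorm0 p : seminorm p -> p 0 = 0.
Proof.
move=> [pD pZ]; have := pZ 0 0; have := pD 0 0.
by rewrite addr0 scale0r normc0 mul0r => ? ?; lra.
Qed.

Lemma seminormZ p a v : seminorm p -> p (a *: v) = normc a * p v.
Proof.
move=> sp; have [_ pZ] := sp; apply/le_anti; rewrite pZ/=.
have [->|a0] := eqVneq a 0; first by rewrite normc0 mul0r scale0r seminorm0.
have na0 : 0 < normc a by rewrite normc_gt0.
by rewrite mulrC -ler_pdivlMr// mulrC -normcV -[in leLHS](scalerK a0 v).
Qed.

Lemma seminorm_ge0 p v : seminorm p -> 0 <= p v.
Proof.
move=> sp; have := sp.1 v (-1 *: v).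
by rewrite seminormZ// scaleN1r subrr seminorm0// normcN normc1 mul1r => ?; lra.
Qed.

(** The functional is extended along an arbitrary linear map rather than a
    subspace inclusion: this covers at once extension from a subspace, norming
    functionals, and the factorization of a functional through a tuple of
    operators. *)
Theorem hahn_banach (X : lmodType R[i]) (p : V -> R) (Psi : X -> V)
    (g : X -> R[i]^o) :
  seminorm p -> linear Psi -> linear g ->
  (forall x, normc (g x) <= p (Psi x)) ->
  exists F : V -> R[i]^o,
    [/\ linear F, forall v, normc (F v) <= p v & forall x, F (Psi x) = g x].
Proof.
move=> sp lPsi lg gp.
have lin0 (W : lmodType R[i]) (h : X -> W) : linear h -> h 0 = 0.
  by move=> /(_ (-1) 0 0); rewrite !scaleN1r !addNr.
pose G0 := [set ((Psi x : realified V), complex.Re (g x)) | x in [set: X]].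
have [|t v t0|||u [ulin up uG0]] := @real_hahn_banach R (realified V) p _ _ G0.
- exact: sp.1.
- by rewrite (seminormZ t%:C (v : V) sp) normc_real// ltW.
- split.
    move=> t _ _ _ _ [x _ [<- <-]] [y _ [<- <-]].
    exists (t%:C *: x + y) => //; rewrite lPsi lg; congr pair.
    by case: (g x) (g y) => a b [c d] /=; rewrite mul0r subr0.
  by move=> _ _ [x _ [<- <-]]; exact: le_trans (Re_le_normc _) _.
- by exists 0 => //; rewrite !lin0.
have uD v w : u (v + w) = u v + u w.
  by have := ulin 1 v w; rewrite scale1r mul1r.
have u0 : u 0 = 0 by have := uD 0 0; rewrite addr0 => ?; lra.
have uZ (t : R) (v : V) : u (t%:C *: v) = t * u v.
  by have := ulin t v 0; rewrite !addr0 u0 addr0.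
(* The only complex-linear map with real part u. *)
pose F (v : V) : R[i]^o := u v -i* u ('i *: v).
have FD v w : F (v + w) = F v + F w.
  by rewrite /F scalerDr !uD opprD.
have Fi v : F ('i *: v) = 'i * F v.
  rewrite /F scalerA -expr2 sqr_i scaleN1r.
  have -> : u (- v) = - u v by have := uD v (- v); rewrite subrr u0 => ?; lra.
  by rewrite opprK; simpc.
have Fr (t : R) v : F (t%:C *: v) = t%:C * F v.
  by rewrite /F scalerA mulrC -scalerA !uZ; simpc.
have FZ a v : F (a *: v) = a * F v.
  rewrite [a]complexE scalerDl FD Fr -scalerA Fi Fr mulrA -mulrDl.
  by [].
exists F; split.
- by move=> a v w; rewrite FD FZ.
- move=> v; have [b b1 bF] := normc_rotate (F v).
  rewrite -[leLHS]/(complex.Re (normc (F v))%:C) -bF -FZ /=.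
  by rewrite (le_trans (up _))// (seminormZ b v sp) b1 mul1r.
- move=> x; rewrite /F -[u _]/(u (Psi x)).
  rewrite (uG0 (Psi x) (complex.Re (g x))); last by exists x.
  have lPsiZ a y : Psi (a *: y) = a *: Psi y.
    by have := lPsi a y 0; rewrite !addr0 lin0// addr0.
  rewrite -lPsiZ (uG0 (Psi ('i *: x)) (complex.Re (g ('i *: x)))); last first.
    by exists ('i *: x).
  have -> : g ('i *: x) = 'i * g x.
    by have := lg 'i x 0; rewrite !addr0 (lin0 _ _ lg) addr0.
  by case: (g x) => a b; simpc.
Qed.

Corollary norming_functional (p : V -> R) (v : V) : seminorm p ->
  exists F : V -> R[i]^o,
    [/\ linear F, forall w, normc (F w) <= p w & F v = (p v)%:C].
Proof.
move=> sp.
have [a x y|a x y|a|F [Flin Fp Fv]] :=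
    @hahn_banach R[i]^o p (fun a => a *: v) (fun a => a * (p v)%:C) sp.
- by rewrite scalerDl scalerA.
- by rewrite mulrDl scalerAl.
- by rewrite normcM normc_real ?seminorm_ge0// seminormZ.
by exists F; split=> //; have := Fv 1; rewrite scale1r mul1r.
Qed.

End ComplexHahnBanach.

(** * Infimal convolution of seminorms *)

Section InfimalConvolution.
Context {R : realType} {V : lmodType R[i]}.
Variables (a b : V -> R) (W : set V).
Hypotheses (sa : seminorm a) (sb : seminorm b) (W0 : W 0).
Hypothesis Wlin : forall t x y, W x -> W y -> W (t *: x + y).

(** Restricting the first summand to a subspace makes the quotient seminorm
    (a = 0, where only the distance to W counts) an instance. *)
Definition infconv (v : V) : R := inf [set a x + b (v - x) | x in W].

Lemma infconv_has_inf v : has_inf [set a x + b (v - x) | x in W].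
Proof.
split; first by exists (a 0 + b (v - 0)), 0.
by exists 0 => _ [x _ <-]; rewrite addr_ge0 ?seminorm_ge0.
Qed.

Lemma infconv_le v x : W x -> infconv v <= a x + b (v - x).
Proof. by move=> Wx; apply: (ge_inf (infconv_has_inf v).2); exists x. Qed.

Lemma infconv_lt v r : infconv v < r -> exists2 x, W x & a x + b (v - x) < r.
Proof.
by move=> /(inf_lt (infconv_has_inf v).1)[_ [x Wx <-]] xr; exists x.
Qed.

Lemma infconv_ler v : infconv v <= b v.
Proof. by have := infconv_le v W0; rewrite subr0 seminorm0// add0r. Qed.

Lemma infconv_lel v : W v -> infconv v <= a v.
Proof. by move=> /(infconv_le v); rewrite subrr (seminorm0 sb) addr0. Qed.

Lemma infconv_seminorm : seminorm infconv.
Proof.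
split=> [v w|c v].
  apply/ler_addgt0Pr => e e0.
  have e20 : 0 < e / 2 by rewrite divr_gt0.
  have [|x Wx xv] := @infconv_lt v (infconv v + e / 2); first by rewrite ltrDl.
  have [|y Wy yw] := @infconv_lt w (infconv w + e / 2); first by rewrite ltrDl.
  have Wxy : W (x + y) by have := Wlin 1 Wx Wy; rewrite scale1r.
  apply: le_trans (infconv_le _ Wxy) _.
  have := sa.1 x y; have := sb.1 (v - x) (w - y).
  by rewrite addrACA -opprD => ? ?; lra.
have [->|c0] := eqVneq c 0.
  rewrite scale0r normc0 mul0r (le_trans (infconv_ler _))//.
  by rewrite (seminorm0 sb).
have nc0 : 0 < normc c by rewrite normc_gt0.
rewrite mulrC -ler_pdivrMr//; apply: lb_le_inf (infconv_has_inf v).1 _.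
move=> _ [x Wx <-]; rewrite ler_pdivrMr//.
have Wcx : W (c *: x) by have := Wlin c Wx W0; rewrite addr0.
apply: le_trans (infconv_le _ Wcx) _.
by rewrite -scalerBr (seminormZ _ _ sa) (seminormZ _ _ sb) -mulrDr mulrC.
Qed.

End InfimalConvolution.

(** * Bounded operators *)

Section BoundedOperators.
Context {R : realType}.

Lemma rnormZ_normc {E : normedModType R[i]} (a : R[i]) (x : E) :
  rnorm (a *: x) = normc a * rnorm x.
Proof. exact: rnormZ. Qed.

Lemma rnorm_seminorm (E : normedModType R[i]) : seminorm (@rnorm R E).
Proof. by split=> *; [exact: rnormD | rewrite rnormZ_normc]. Qed.

Lemma rnormC (a : R[i]^o) : rnorm a = normc a.
Proof. by []. Qed.

Lemma opnormE {E F : normedModType R[i]} (T : boundedOp E F) :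
  rnorm T = opnorm T.
Proof. by []. Qed.

Lemma bounded_linearP {E F : normedModType R[i]} (f : E -> F) (M : R) :
  linear f -> (forall x, rnorm (f x) <= M * rnorm x) ->
  exists T : boundedOp E F, T =1 f.
Proof.
move=> lf fM; have fP : f \in bounded_linear.
  by apply/asboolP; split=> //; exists M.
by exists (BoundedOp fP).
Qed.

Section RankOne.
Context {E : normedModType R[i]}.

Lemma rank_one_bounded_linear (f : dual E) (y : E) :
  (fun x => (f x : R[i]) *: y) \in bounded_linear.
Proof.
apply/asboolP; split=> [a x z|]; first by rewrite linearP scalerDl scalerA.
exists (opnorm f * rnorm y) => x; rewrite rnormZ_normc mulrAC.
by rewrite ler_wpM2r ?rnorm_ge0//; exact: (opnorm_bound f x).
Qed.

Definition rank_one (f : dual E) (y : E) : boundedOp E E :=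
  BoundedOp (rank_one_bounded_linear f y).

Lemma rank_one_linear y : linear (rank_one^~ y).
Proof.
move=> a f g; apply/val_inj/funext => x /=.
rewrite -[RHS]/(a *: ((f x : R[i]) *: y) + (g x : R[i]) *: y).
by rewrite scalerA -scalerDl.
Qed.

Lemma rank_one_norm f y : opnorm (rank_one f y) <= opnorm f * rnorm y.
Proof.
apply: opnorm_le => [|x]; first by rewrite mulr_ge0 ?opnorm_ge0 ?rnorm_ge0.
rewrite /= rnormZ_normc mulrAC.
by rewrite ler_wpM2r ?rnorm_ge0//; exact: (opnorm_bound f x).
Qed.

Lemma norming_vector (x : E) : exists f : dual E, f x = (rnorm x)%:C.
Proof.
have [F [Flin Fp Fx]] := norming_functional x (rnorm_seminorm E).
have [|f fF] := bounded_linearP (M := 1) Flin.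
  by move=> y; rewrite mul1r rnormC.
by exists f; rewrite fF.
Qed.

Lemma separating_vector (x : E) : (forall f : dual E, f x = 0) -> x = 0.
Proof.
have [f fx] := norming_vector x => /(_ f); rewrite fx => /complexI.
exact: rnorm0_eq0.
Qed.

End RankOne.
End BoundedOperators.

(** * Completeness *)

Section Completeness.
Context {R : realType}.

Lemma gt0_complex (e : R[i]) : 0 < e -> exists2 r : R, 0 < r & e = r%:C.
Proof. by case: e => r s; rewrite ltcE/= => /andP[/eqP-> r0]; exists r. Qed.

Lemma closed_away {F : normedModType R[i]} (L : set F) (x : F) :
  closed L -> ~ L x ->
  exists2 e : R, 0 < e & forall y, L y -> e <= rnorm (x - y).
Proof.
rewrite -openC openE => oL /oL; rewrite /interior.
move=> /nbhs_ballP[_ /= /gt0_complex[e e0 ->] eL].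
exists e => // y Ly; rewrite leNgt; apply/negP => xy; apply: eL Ly.
by rewrite -ball_normE /ball_/= rnormE ltcR.
Qed.

Lemma le0_geometric (r M : R) : (forall n, r <= M / 3 ^+ n) -> r <= 0.
Proof.
move=> rM; apply/ler_addgt0Pr => e e0; rewrite add0r.
pose n := Num.bound (`|M| / e).
apply: le_trans (rM n) _; rewrite ler_pdivrMr ?exprn_gt0//.
rewrite (le_trans (ler_norm M))// mulrC -ler_pdivrMr//.
apply: (@le_trans _ _ n%:R); first apply/ltW/archi_boundP.
  exact: divr_ge0 (normr_ge0 M) (ltW e0).
by rewrite -natrX ler_nat ltnW// ltn_expl.
Qed.

(** The increments 2 c / 3^(n+1) telescope to the remainder c / 3^n. The ratio
    1/3 makes the remainder after a step only half of that step, which lets a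
    step outweigh all later ones in the proof of uniform boundedness. *)
Section GeometricLimit.
Context {E : completeNormedModType R[i]}.
Variables (x : nat -> E) (c : R).
Hypothesis xc : forall n, rnorm (x n.+1 - x n) <= 2 * (c / 3 ^+ n.+1).

Lemma geometric_gap n k :
  rnorm (x (n + k)%N - x n) <= c / 3 ^+ n - c / 3 ^+ (n + k).
Proof.
elim: k => [|k IHk]; first by rewrite addn0 !subrr rnorm0.
have -> : x (n + k.+1)%N - x n =
      (x (n + k).+1 - x (n + k)%N) + (x (n + k)%N - x n).
  by rewrite addrA subrK addnS.
apply: le_trans (rnormD _ _) _; have := xc (n + k).
have : c / 3 ^+ (n + k) = 3 * (c / 3 ^+ (n + k).+1).
  by rewrite exprS invfM [in RHS]mulrCA [3 * _]mulrA divff ?mul1r.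
by rewrite addnS; lra.
Qed.

Lemma geometric_limit : exists l : E, forall n, rnorm (l - x n) <= c / 3 ^+ n.
Proof.
have c0 : 0 <= c.
  have := le_trans (rnorm_ge0 _) (xc 0); rewrite expr1 => ?; lra.
have gap n m : (n <= m)%N -> rnorm (x m - x n) <= c / 3 ^+ n.
  move=> /subnKC <-; apply: le_trans (geometric_gap _ _) _.
  by rewrite gerBl divr_ge0// exprn_ge0.
have small (e : R) : 0 < e -> exists n, c / 3 ^+ n < e.
  move=> e0; apply: contrapT => /forallNP ne.
  have := @le0_geometric e c; rewrite leNgt e0 => /(_ _)/negP[]//.
  by move=> n; rewrite leNgt; apply/negP/ne.
have : cvg (x @ \oo).
  apply/cauchy_cvgP/cauchy_exP => _ /gt0_complex[e /small[n ne] ->].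
  exists (x n); exists n => // m /= nm.
  rewrite -ball_normE /ball_/= distrC rnormE ltcR.
  exact: le_lt_trans (gap _ _ nm) ne.
move=> /cvg_ex[l xl]; exists l => n.
apply/ler_addgt0Pr => e e0.
have /cvgrPdist_lt/(_ e%:C) := xl; rewrite (ltcR 0) => /(_ e0)[m _ me].
have /= := me (maxn m n) (leq_maxl _ _); rewrite rnormE ltcR => le1.
have le2 := gap _ _ (leq_maxr m n).
rewrite -(subrK (x (maxn m n)) l) -addrA (le_trans (rnormD _ _))//.
by rewrite [leRHS]addrC lerD// ltW.
Qed.

End GeometricLimit.

Lemma opnorm_geometric_limit {E : normedModType R[i]}
    {F : completeNormedModType R[i]} (T : nat -> boundedOp E F) (c : R) :
  (forall n, opnorm (T n.+1 - T n) <= 2 * (c / 3 ^+ n.+1)) ->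
  exists S : boundedOp E F, forall n, opnorm (S - T n) <= c / 3 ^+ n.
Proof.
move=> Tc.
have c0 : 0 <= c.
  have := le_trans (opnorm_ge0 _) (Tc 0); rewrite expr1 => ?; lra.
have cn0 n : 0 <= c / 3 ^+ n by rewrite divr_ge0// exprn_ge0.
have lim u : exists l, forall n, rnorm (l - T n u) <= c * rnorm u / 3 ^+ n.
  apply: geometric_limit => n.
  apply: le_trans (opnorm_bound (T n.+1 - T n) u) _.
  by rewrite mulrAC mulrA ler_wpM2r ?rnorm_ge0.
have [S ST] := choice lim.
have Slin : linear S.
  move=> a u v; apply/eqP; rewrite -subr_eq0; apply/eqP/rnorm0_eq0.
  apply/le_anti; rewrite rnorm_ge0 andbT.
  pose M := c * (rnorm (a *: u + v) + normc a * rnorm u + rnorm v).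
  apply: (@le0_geometric _ M) => n; rewrite /M.
  have -> : S (a *: u + v) - (a *: S u + S v) =
      (S (a *: u + v) - T n (a *: u + v)) -
      (a *: (S u - T n u) + (S v - T n v)).
    by rewrite (linearP (T n)) scalerBr addrACA -opprD opprB addrA subrK.
  rewrite -scaleN1r (le_trans (rnormD _ _))// rnormZ_normc normcN normc1 mul1r.
  have := rnormD (a *: (S u - T n u)) (S v - T n v); rewrite rnormZ_normc.
  have := ler_wpM2l (normc_ge0 a) (ST u n).
  have := ST v n; have := ST (a *: u + v) n.
  by rewrite mulrDr mulrDr !mulrDl mulrCA !mulrA; lra.
have [|S' S'E] := bounded_linearP (M := c + opnorm (T 0)) Slin.
  move=> u; rewrite -(subrK (T 0 u) (S u)) mulrDl (le_trans (rnormD _ _))//.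
  by rewrite lerD ?opnorm_bound//; have := ST u 0; rewrite expr0 divr1.
exists S' => n; apply: opnorm_le => // u.
by rewrite -[X in rnorm X]/(S' u - T n u) S'E mulrAC.
Qed.

End Completeness.

(** * Uniform boundedness on a closed subspace of operators *)

Section UniformBoundedness.
Context {R : realType}.
Context {E : normedModType R[i]} {F : completeNormedModType R[i]}.
Variables (L : set (boundedOp E F)) (q : E -> R).
Hypotheses (cL : closed L) (L0 : L 0).
Hypothesis Llin : forall (a : R[i]) S T, L S -> L T -> L (a *: S + T).
Hypothesis q0 : forall u, 0 <= q u.
Hypothesis Lq : forall T, L T -> exists M, forall u, rnorm (T u) <= M * q u.

Let values (u : E) := [set rnorm (T u) | T in L `&` [set T | opnorm T <= 1]].
(** The norm of the evaluation at u, as a map on L. *)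
Let N (u : E) := sup (values u).

Let values_has_sup u : has_sup (values u).
Proof.
split.
  exists (rnorm ((0 : boundedOp E F) u)), 0 => //.
  by split=> //=; rewrite -opnormE rnorm0.
exists (rnorm u) => _ [T [_ /= T1] <-]; apply: le_trans (opnorm_bound T u) _.
by rewrite ler_piMl ?rnorm_ge0.
Qed.

Let N_ge0 u : 0 <= N u.
Proof.
apply: (@le_trans _ _ (rnorm ((0 : boundedOp E F) u))); first exact: rnorm_ge0.
apply: (ub_le_sup (values_has_sup u).2); exists 0 => //.
by split=> //=; rewrite -opnormE rnorm0.
Qed.

Let LZ a T : L T -> L (a *: T).
Proof. by move=> LT; rewrite -[_ *: _]addr0; exact: Llin. Qed.

Let LB S T : L S -> L T -> L (S - T).
Proof. by move=> LS LT; rewrite addrC -scaleN1r; exact: Llin. Qed.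

Let N_bound T u : L T -> rnorm (T u) <= opnorm T * N u.
Proof.
move=> LT; have [T0|T0] := eqVneq (opnorm T) 0.
  by rewrite T0 mul0r -[leRHS](mul0r (rnorm u)) -T0 opnorm_bound.
have T_gt0 : 0 < opnorm T by rewrite lt_neqAle eq_sym T0 opnorm_ge0.
rewrite mulrC -ler_pdivrMr//; apply: (ub_le_sup (values_has_sup u).2).
exists ((opnorm T)^-1%:C *: T).
  split; first exact: LZ.
  rewrite /= -opnormE rnormZ_normc normc_real ?invr_ge0 ?opnorm_ge0//.
  by rewrite opnormE mulVf.
rewrite -[X in rnorm X]/(_ *: T u) rnormZ_normc.
by rewrite normc_real ?invr_ge0 ?opnorm_ge0// mulrC.
Qed.

(** T u is half the difference of (S + T) u and (S - T) u, so one of these is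
    at least as large as T u. *)
Let larger_sum (S T : boundedOp E F) u :
  exists S', [/\ L S -> L T -> L S', opnorm (S' - S) <= opnorm T &
    rnorm (T u) <= rnorm (S' u)].
Proof.
have [le|lt] := leP (rnorm (T u)) (rnorm ((S + T) u)).
  exists (S + T); split=> //; last by rewrite addrC addKr.
  by move=> LS LT; have := Llin 1 LS LT; rewrite scale1r.
exists (S - T); split; first exact: LB.
  by rewrite addrC addKr -!opnormE -scaleN1r rnormZ_normc normcN normc1 mul1r.
have := rnormD ((S + T) u) (-1 *: (S - T) u).
have -> : (S + T) u + -1 *: (S - T) u = 2 *: T u.
  rewrite -[(S + T) u]/(S u + T u) -[(S - T) u]/(S u - T u).
  by rewrite scaleN1r opprB addrC addrA subrK -mulr2n -scaler_nat.
rewrite !rnormZ_normc normcN normc1 mul1r.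
rewrite -(rmorph_nat (real_complex R) 2) normc_real//.
by have := ltW lt; lra.
Qed.

(** Otherwise N u, the norm of the evaluation at u, is bounded by no multiple
    of q u. Along vectors u_n where it exceeds larger and larger multiples, a
    series of operators in L is summed with signs chosen so that the n-th
    partial sum is large at u_n; the later terms are too small to compensate,
    and the sum S, which lies in L, is bounded by no multiple of q. *)
Theorem uniform_boundedness :
  exists2 C, 0 <= C & forall T u, L T -> rnorm (T u) <= C * opnorm T * q u.
Proof.
apply: contrapT => noC.
(* The factor 3/4, instead of an attained supremum, still leaves the n-th step
   3/4 * 2/3^(n+1) * N larger than the remainder 1/3^(n+1) * N. *)
have big n : exists uT : E * boundedOp E F,
    [/\ L uT.2, opnorm uT.2 <= 1, 3 / 4 * N uT.1 < rnorm (uT.2 uT.1) &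
      2 * 3 ^+ n.+1 * n%:R * q uT.1 < N uT.1].
  have C0 : 0 <= 2 * 3 ^+ n.+1 * n%:R :> R by rewrite !mulr_ge0// exprn_ge0.
  have [u Nu] : exists u, 2 * 3 ^+ n.+1 * n%:R * q u < N u.
    apply: contrapT => /forallNP Nu; apply: noC.
    exists (2 * 3 ^+ n.+1 * n%:R) => // T u LT.
    apply: le_trans (N_bound u LT) _; rewrite mulrAC mulrC.
    rewrite ler_wpM2r ?opnorm_ge0//.
    by rewrite leNgt; apply/negP.
  have Nu0 : 0 < N u by apply: le_lt_trans Nu; rewrite mulr_ge0.
  have : 3 / 4 * N u < N u by lra.
  by move=> /(sup_gt (values_has_sup u).1)[_ [T [LT T1] <-] NT]; exists (u, T).
have [uT uTP] := choice big.
pose D n := (2 / 3 ^+ n.+1)%:C *: (uT n).2.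
have d0 n : 0 <= 2 / 3 ^+ n.+1 :> R by rewrite divr_ge0// exprn_ge0.
have [next nextP] := choice (fun nS : nat * boundedOp E F =>
  larger_sum nS.2 (D nS.1) (uT nS.1).1).
pose B := fix B n := if n is m.+1 then next (m, B m) else 0.
have LD n : L (D n) by apply: LZ; have [] := uTP n.
have LBn n : L (B n).
  by elim: n => //= n IHn; have [+ _ _] := nextP (n, B n); exact.
have [n|S SB] := opnorm_geometric_limit (T := B) (c := 1).
  have [_ + _] := nextP (n, B n) => /le_trans-> //=.
  rewrite -opnormE rnormZ_normc normc_real// mulrA mulr1 ler_piMr//.
  by have [_ ? _ _] := uTP n.
have LS : L S.
  apply: contrapT => /(closed_away cL)[e e0 Be].
  suff : e <= 0 by rewrite leNgt e0.
  by apply: (@le0_geometric _ _ 1) => n; apply: le_trans (SB n); exact: Be.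
have [M SM] := Lq LS.
pose n := (Num.bound `|M|); have Mn : M <= n%:R.
  by apply: le_trans (ler_norm M) _; rewrite ltW// archi_boundP.
have [_ _ Tu Nu] := uTP n; set u := (uT n).1 in Tu Nu.
have [_ _ /= Bu] := nextP (n, B n); rewrite -/u in Bu.
have tail : rnorm ((S - B n.+1) u) <= 1 / 3 ^+ n.+1 * N u.
  by apply: le_trans (N_bound u (LB LS (LBn n.+1))) _; rewrite ler_wpM2r.
have Du : rnorm (D n u) = 2 / 3 ^+ n.+1 * rnorm ((uT n).2 u).
  by rewrite -[X in rnorm X]/(_ *: (uT n).2 u) rnormZ_normc normc_real.
have tri : rnorm (B n.+1 u) <= rnorm (S u) + rnorm ((S - B n.+1) u).
  have -> : B n.+1 u = S u + -1 *: (S - B n.+1) u.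
    by rewrite -[(S - _) u]/(S u - B n.+1 u) scaleN1r opprB addrC subrK.
  by apply: le_trans (rnormD _ _) _; rewrite rnormZ_normc normcN normc1 mul1r.
have SMu := SM u; have Mnq := ler_wpM2r (q0 u) Mn.
have i0 : 0 < (3 ^+ n.+1)^-1 :> R by rewrite invr_gt0 exprn_gt0.
have lo : 3 / 2 * (3 ^+ n.+1)^-1 * N u <= rnorm (D n u).
  by rewrite Du; have := ler_wpM2l (ltW i0) (ltW Tu); lra.
have hi : 2 * n%:R * q u < (3 ^+ n.+1)^-1 * N u.
  rewrite [ltRHS]mulrC ltr_pdivlMr ?exprn_gt0//; apply: le_lt_trans Nu.
  by rewrite le_eqVlt; apply/orP; left; apply/eqP; ring.
by have := le_trans lo (le_trans Bu tri); lra.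
Qed.

End UniformBoundedness.

(** * Finite-rank operators in a left ideal *)

Section FiniteRank.
Context {R : realType} {E : normedModType R[i]}.

Lemma op_linearB {F : normedModType R[i]} (T : boundedOp E F) x y :
  T (x - y) = T x - T y.
Proof. exact: linearB. Qed.

Lemma op_linearZ {F : normedModType R[i]} (T : boundedOp E F) a x :
  T (a *: x) = a *: T x.
Proof. exact: linearZ. Qed.

Lemma op_linear_sum {F : normedModType R[i]} (T : boundedOp E F) n
    (x : 'I_n -> E) :
  T (\sum_i x i) = \sum_i T (x i).
Proof. exact: linear_sum. Qed.

Lemma dual_comp_bounded_linear (f : dual E) (T : boundedOp E E) :
  (fun x => f (T x)) \in bounded_linear.
Proof.
apply/asboolP; split=> [a x y|]; first by rewrite !linearP.
exists (opnorm f * opnorm T) => x.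
apply: le_trans (opnorm_bound f (T x)) _.
by rewrite -mulrA ler_wpM2l ?opnorm_ge0// opnorm_bound.
Qed.

Definition dual_comp (f : dual E) (T : boundedOp E E) : dual E :=
  BoundedOp (dual_comp_bounded_linear f T).

Lemma rank_one_comp f T y : rank_one f y * T = rank_one (dual_comp f T) y.
Proof. exact/val_inj. Qed.

Lemma finite_rank_rank_one (f : dual E) (x y : E) :
  f x != 0 -> finite_rank (rank_one f y).
Proof.
move=> fx0; exists 1%N, (fun=> y).
apply/seteqP; split=> [_ [z _ <-]|_ [c _ <-]].
  by exists (fun=> f z) => //; rewrite big_ord1.
exists ((c ord0 / (f x : R[i])) *: x) => //.
by rewrite big_ord1 /= op_linearZ /=; congr (_ *: _); exact: divfK.
Qed.

(** Splitting off one rank-one operator (f o T) w with f w = 1 leaves the range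
    inside the kernel of f on the old span, which one vector fewer spans. The
    Hahn-Banach functional f is bounded by construction, so that coordinates
    on the range need not be shown continuous. *)
Lemma finite_rank_sub (A : set (boundedOp E E)) :
  A 0 -> (forall S T, A S -> A T -> A (S + T)) ->
  (forall f y, A (rank_one f y)) -> finite_rank `<=` A.
Proof.
move=> A0 AD A1.
have span n : forall (e : 'I_n -> E) (T : boundedOp E E),
    (forall x, exists c : 'I_n -> R[i], T x = \sum_i c i *: e i) -> A T.
  elim: n => [e T Te|n IHn e T Te].
    suff -> : T = 0 by [].
    by apply/val_inj/funext => x /=; have [c ->] := Te x; rewrite big_ord0.
  have [T0|/existsNP[x0 /eqP Tx0]] := pselect (forall x, T x = 0).
    by suff -> : T = 0 by []; apply/val_inj/funext => x /=; rewrite T0.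
  have [f fT] := norming_vector (T x0).
  have fT0 : f (T x0) != 0.
    rewrite fT; apply: contra_neq Tx0 => /complexI; exact: rnorm0_eq0.
  pose h := dual_comp f T; pose w := (f (T x0) : R[i])^-1 *: T x0.
  have fw : f w = 1 by rewrite /w op_linearZ /=; exact: mulVf.
  rewrite -(subrK (rank_one h w) T); apply: AD => //.
  have [j fj] : exists j, f (e j) != 0.
    apply: contrapT => /forallNP fe; move/negP: fT0; apply; apply/eqP.
    have [c ->] := Te x0; rewrite op_linear_sum big1// => i _.
    have /negP := fe i; rewrite negbK => /eqP fei.
    by rewrite op_linearZ /= fei scaler0.
  pose k i : R[i] := (f (e (lift j i)) : R[i]) / (f (e j) : R[i]).
  apply: (IHn (fun i => e (lift j i) - k i *: e j)) => x.
  pose z := x - (f (T x) : R[i]) / (f (T x0) : R[i]) *: x0.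
  have Tx : (T - rank_one h w) x = T z.
    rewrite -[LHS]/(T x - (f (T x) : R[i]) *: w).
    by rewrite /z op_linearB op_linearZ /w scalerA.
  have [d dE] := Te z.
  exists (fun i => d (lift j i)); rewrite Tx dE.
  have : f (\sum_i d i *: e i) = 0.
    rewrite -dE -Tx -[(T - _) x]/(T x - (f (T x) : R[i]) *: w).
    by rewrite op_linearB op_linearZ fw -[_ *: _]/(_ * _) mulr1 subrr.
  rewrite op_linear_sum (bigD1_ord j) //= op_linearZ /= => fd.
  have {}fd : d j = - \sum_i d (lift j i) * k i.
    apply: (mulIf fj); apply/eqP; rewrite -subr_eq0 mulNr opprK; apply/eqP.
    rewrite -[RHS]fd; congr (_ + _); rewrite mulr_suml; apply: eq_bigr => i _.
    by rewrite op_linearZ -mulrA /k divfK.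
  rewrite (bigD1_ord j) //= fd scaleNr addrC scaler_suml -sumrB.
  by apply: eq_bigr => i _; rewrite scalerBr scalerA.
by move=> T [n [e Te]]; apply: (span n e) => x;
  have : range T (T x) by [exists x]; rewrite Te => -[c _ <-]; exists c.
Qed.

End FiniteRank.

Section ClosedLeftIdeal.
Context {R : realType} {E : normedModType R[i]}.
Variable L : set (boundedOp E E).
Hypotheses (lL : left_ideal L) (cL : closed L).
(** Equivalent to L lying in no fixed maximal left ideal. *)
Hypothesis sepL : forall x, (forall T, L T -> T x = 0) -> x = 0.

Lemma left_ideal_linear (a : R[i]) S T : L S -> L T -> L (a *: S + T).
Proof.
have [_ LD LM] := lL => LS LT; apply: LD => //.
by rewrite (_ : _ *: _ = (a *: id_op) * S); [exact: LM | exact/val_inj].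
Qed.

(** If the functionals of the rank-one operators in L were not the whole dual,
    some nonzero element of the bidual would vanish on them; reflexivity makes
    it the evaluation at a vector that L annihilates. *)
Lemma reflexive_rank_one : reflexive_space E -> forall f y, L (rank_one f y).
Proof.
move=> refl g0 y0; apply: contrapT => Lg0.
have [e e0 Le] := closed_away cL Lg0.
pose K : set (dual E) := [set g | L (rank_one g y0)].
have K0 : K 0.
  have [L0 _ _] := lL; rewrite /K /= (_ : rank_one 0 y0 = 0)//.
  by apply/val_inj/funext => x /=; rewrite scale0r.
have Klin a f g : K f -> K g -> K (a *: f + g).
  by rewrite /K/= rank_one_linear; exact: left_ideal_linear.
have s0 : seminorm (fun _ : dual E => 0 : R).
  by split=> *; rewrite ?addr0 ?mulr0.
have sK := infconv_seminorm s0 (rnorm_seminorm (dual E)) K0 Klin.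
have [F [Flin Fp Fg0]] := norming_functional g0 sK.
have [f|phi phiF] := bounded_linearP (M := 1) Flin.
  rewrite mul1r rnormC.
  exact: le_trans (Fp f) (infconv_ler s0 (rnorm_seminorm _) K0 f).
have [x xphi] := refl phi.
have Fx g : F g = g x by rewrite -phiF -xphi.
have FK g : K g -> F g = 0.
  move=> Kg; apply: eq0_normc; apply/le_anti; rewrite normc_ge0 andbT.
  exact: le_trans (Fp g) (infconv_lel s0 (rnorm_seminorm _) K0 Kg).
have x0 : x = 0.
  apply: sepL => T LT; apply: separating_vector => f.
  rewrite -[LHS]/(dual_comp f T x) -Fx FK// /K/= -rank_one_comp.
  by have [_ _ LM] := lL; exact: LM.
have : 0 < infconv (fun=> 0) rnorm K g0.
  rewrite lt_neqAle seminorm_ge0// andbT eq_sym; apply/eqP => d0.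
  have ny0 : 0 < rnorm y0 + 1 by rewrite ltr_wpDl ?rnorm_ge0.
  have [|g Kg] := infconv_lt s0 (rnorm_seminorm (dual E)) K0
    (v := g0) (r := e / (rnorm y0 + 1)).
    by rewrite d0 divr_gt0.
  rewrite add0r ltr_pdivlMr//; apply/negP; rewrite -leNgt.
  apply: le_trans (Le _ Kg) _.
  have -> : rank_one g0 y0 - rank_one g y0 = rank_one (g0 - g) y0.
    by apply/val_inj/funext => z; exact: esym (scalerBl (g0 z : R[i]) (g z) y0).
  apply: le_trans (rank_one_norm _ _) _.
  by rewrite ler_wpM2l ?opnorm_ge0// lerDl.
by move: Fg0; rewrite Fx x0 linear0 => /complexI <-; rewrite ltxx.
Qed.

End ClosedLeftIdeal.

(** * Finitely generated closed left ideals *)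

Section FinitelyGenerated.
Context {R : realType} {E : completeNormedModType R[i]}.
Local Notation B := (boundedOp E E).

(** The norm of the image of u under the column operator u |-> (t u)_t; its
    being bounded below says that this operator is injective of closed range. *)
Definition joint_norm (s : seq B) (u : E) : R := \sum_(t <- s) rnorm (t u).

Lemma joint_norm_seminorm s : seminorm (joint_norm s).
Proof.
split=> [u v|a u].
  rewrite -big_split; apply: ler_sum => t _.
  by rewrite [t (u + v)]linearD; exact: rnormD.
rewrite mulr_sumr; apply: ler_sum => t _.
by rewrite op_linearZ rnormZ_normc.
Qed.

Lemma joint_norm_le s u : joint_norm s u <= (\sum_(t <- s) opnorm t) * rnorm u.
Proof. by rewrite mulr_suml; apply: ler_sum => t _; exact: opnorm_bound. Qed.

(** The operators dominated by a multiple of the joint norm form a left ideal,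
    which contains the generators. *)
Lemma generated_dominated (G : set B) (s : seq B) :
  (forall t, G t -> t \in s) ->
  forall T, smallest left_ideal G T ->
  exists M, forall u, rnorm (T u) <= M * joint_norm s u.
Proof.
move=> Gs.
have j0 u : 0 <= joint_norm s u := seminorm_ge0 u (joint_norm_seminorm s).
apply: smallest_sub; first split.
- by exists 0 => u; rewrite mul0r -[X in rnorm X]/(0 : E) rnorm0.
- move=> S T [M SM] [N TN]; exists (M + N) => u.
  by rewrite mulrDl; apply: le_trans (rnormD (S u) (T u)) (lerD (SM u) (TN u)).
- move=> S T [M TM]; exists (opnorm S * M) => u.
  apply: le_trans (opnorm_bound S (T u)) _.
  by rewrite -mulrA ler_wpM2l ?opnorm_ge0.
move=> t /Gs ts; exists 1 => u; rewrite mul1r /joint_norm (big_rem t)//=.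
by rewrite lerDl sumr_ge0// => *; exact: rnorm_ge0.
Qed.

Variables (L : set B) (s : seq B).
Hypotheses (lL : left_ideal L) (s_uniq : uniq s).
Hypothesis sL : forall t, t \in s -> L t.

(** Hahn-Banach extends g from the image of u |-> (t u)_t to all families of
    vectors; the components f_t of the extension give g = \sum_t f_t o t. *)
Lemma dominated_rank_one (g : dual E) (m : R) (y : E) : 0 <= m ->
  (forall u, normc (g u) <= m * joint_norm s u) -> L (rank_one g y).
Proof.
move=> m0 gm.
pose p (v : B -> E) := m * \sum_(t <- s) rnorm (v t).
have sp : seminorm p.
  split=> [v w|a v].
    rewrite /p -mulrDr -big_split; apply: ler_wpM2l => //.
    apply: ler_sum => t _.
    exact: rnormD.
  rewrite /p mulrCA; apply: ler_wpM2l => //.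
  rewrite mulr_sumr; apply: ler_sum => t _.
  by rewrite -[(a *: v) t]/(a *: v t) rnormZ_normc.
pose family (u : E) : B -> E := fun t => t u.
have familylin : linear family.
  by move=> a u v; apply/funext => t; exact: op_linear.
have [F [Flin Fp Fg]] := hahn_banach sp familylin (op_linear g) gm.
have FD v w : F (v + w) = F v + F w.
  by have := Flin 1 v w; rewrite !scale1r.
have F0 : F 0 = 0 by have := Flin (-1) 0 0; rewrite !scaleN1r !addNr.
pose single t (z : E) : B -> E := fun t' => if t' == t then z else 0.
have single_lin t : linear (single t).
  move=> a z w; apply/funext => t'.
  rewrite -[RHS]/(a *: single t z t' + single t w t').
  by rewrite /single; case: ifP => // _; rewrite scaler0 addr0.
have single_le t z : rnorm (F (single t z)) <= m * (size s)%:R * rnorm z.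
  rewrite rnormC (le_trans (Fp _))// -mulrA ler_wpM2l//.
  rewrite mulr_natl -sum1_size -sumrMnr; apply: ler_sum => t' _; rewrite mulr1n.
  by rewrite /single; case: ifP => // _; rewrite rnorm0 rnorm_ge0.
have component t : exists f : dual E, f =1 (fun z => F (single t z)).
  by apply: bounded_linearP (single_le t) => a z w; rewrite single_lin Flin.
have [f fF] := choice component.
have gE u : g u = \sum_(t <- s) f t (t u).
  have split_family : F (family u - \sum_(t <- s) single t (t u)) = 0.
    apply: eq0_normc; apply/le_anti; rewrite normc_ge0 andbT.
    rewrite (le_trans (Fp _))// /p big_seq big1 ?mulr0// => t ts.
    suff -> : (family u - \sum_(t <- s) single t (t u)) t = 0 by rewrite rnorm0.
    rewrite -[LHS]/(t u - (\sum_(t <- s) single t (t u)) t) fct_sumE.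
    rewrite (bigD1_seq t)//= {1}/single eqxx big1 ?addr0 ?subrr// => t' t't.
    by rewrite /single eq_sym (negbTE t't).
  rewrite -Fg -[X in F X](subrK (\sum_(t <- s) single t (t u))) FD.
  rewrite split_family add0r (big_morph F FD F0); apply: eq_bigr => t _.
  by rewrite fF.
have -> : rank_one g y = \sum_(t <- s) rank_one (f t) y * t.
  apply/val_inj/funext => u /=.
  rewrite (@big_morph _ _ (fun T : B => T u) 0 +%R 0 +%R)// gE scaler_suml.
  by apply: eq_bigr.
have [L0 LD LM] := lL; rewrite big_seq.
by elim/big_ind : _ => // t /sL; exact: LM.
Qed.

Hypothesis cL : closed L.
Hypothesis sepL : forall x, (forall T, L T -> T x = 0) -> x = 0.
Hypothesis Ls : forall T, L T ->
  exists M, forall u, rnorm (T u) <= M * joint_norm s u.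

Let j0 u : 0 <= joint_norm s u := seminorm_ge0 u (joint_norm_seminorm s).

Lemma joint_norm_eq0 u : joint_norm s u = 0 -> u = 0.
Proof.
move=> ju0; apply: sepL => T /Ls[M /(_ u)]; rewrite ju0 mulr0 => Tu.
by apply: rnorm0_eq0; apply/le_anti; rewrite Tu rnorm_ge0.
Qed.

Let EW (t : R[i]) (x y : E) :
  [set: E] x -> [set: E] y -> [set: E] (t *: x + y) := fun _ _ => I.

Let scaled_seminorm N : 0 <= N -> seminorm (fun u => N * joint_norm s u).
Proof.
move=> N0; have [jD jZ] := joint_norm_seminorm s; split=> [u v|a u].
  by rewrite -mulrDr ler_wpM2l.
by rewrite mulrCA ler_wpM2l.
Qed.

(** A functional norming u for the infimal convolution is dominated by a
    multiple of the joint norm, so its rank-one operators are in L, where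
    uniform boundedness replaces that multiple by one that N does not enter. *)
Lemma infconv_bounded : exists2 C, 0 <= C & forall N u, 0 <= N ->
  infconv rnorm (fun v => N * joint_norm s v) [set: E] u <= C * joint_norm s u.
Proof.
have [L0 _ _] := lL.
have [C C0 CL] := uniform_boundedness cL L0 (left_ideal_linear lL) j0 Ls.
exists C => // N u N0.
have sN := scaled_seminorm N0.
have sI := infconv_seminorm (rnorm_seminorm E) sN I EW.
have [->|u0] := eqVneq u 0; first by rewrite seminorm0// mulr_ge0.
have [F [Flin Fp Fu]] := norming_functional u sI.
have Fnorm v : rnorm (F v) <= 1 * rnorm v.
  rewrite mul1r rnormC.
  exact: le_trans (Fp v) (infconv_lel (rnorm_seminorm E) sN I I).
have [g gF] := bounded_linearP Flin Fnorm.
have g1 : opnorm g <= 1 by apply: opnorm_le => // v; rewrite gF.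
have Lg : L (rank_one g u).
  apply: (dominated_rank_one u N0) => v; rewrite gF.
  exact: le_trans (Fp v) (infconv_ler (rnorm_seminorm E) sN I v).
have nu0 : 0 < rnorm u.
  rewrite lt_neqAle rnorm_ge0 andbT eq_sym.
  by apply: contra_neq u0; exact: rnorm0_eq0.
have gu : rnorm (rank_one g u u) =
    infconv rnorm (fun v => N * joint_norm s v) [set: E] u * rnorm u.
  by rewrite rnormZ_normc gF Fu normc_real// seminorm_ge0.
rewrite -(ler_pM2r nu0) -gu (le_trans (CL _ u Lg))// mulrAC.
rewrite ler_wpM2l ?mulr_ge0// (le_trans (rank_one_norm g u))//.
by rewrite ler_piMl// ltW.
Qed.

(** Each remainder r is approximated by some x of norm at most C + 1 times the
    joint norm of r, up to an error whose joint norm is three times smaller;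
    the sum of these x converges since E is complete, and equals u because the
    joint norm vanishes only at 0. *)
Lemma joint_norm_bounded_below :
  exists2 c, 0 <= c & forall u, rnorm u <= c * joint_norm s u.
Proof.
have [C C0 CN] := infconv_bounded.
have approx r : exists x, rnorm x <= (C + 1) * joint_norm s r /\
    joint_norm s (r - x) <= joint_norm s r / 3.
  have [r0|r0] := eqVneq (joint_norm s r) 0.
    by exists 0; rewrite subr0 rnorm0 r0 mulr0 mul0r.
  have r_gt0 : 0 < joint_norm s r by rewrite lt_neqAle eq_sym r0 j0.
  (* With this N, the summand N q(r - x) <= (C + 1) q(r) of the infimal
     convolution forces the factor 1/3. *)
  have N0 : 0 <= 3 * (C + 1) by lra.
  have [|x _ xr] := infconv_lt (rnorm_seminorm E) (scaled_seminorm N0)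
    (W := [set: E]) I (v := r) (r := (C + 1) * joint_norm s r).
    by apply: le_lt_trans (CN _ _ N0) _; rewrite ltr_pM2r// ltrDl.
  exists x; have := rnorm_ge0 x; have := j0 (r - x) => jx0 x0.
  have N1 : 0 <= 3 * (C + 1) * joint_norm s (r - x) by rewrite mulr_ge0.
  split; first by lra.
  have C1 : 0 < C + 1 by lra.
  rewrite -(ler_pM2l C1); lra.
have [h hP] := choice approx.
exists (3 / 2 * (C + 1)) => [|u]; first by lra.
pose r := fix r n := if n is m.+1 then r m - h (r m) else u.
have jr n : joint_norm s (r n) <= joint_norm s u / 3 ^+ n.
  elim: n => [|n IHn]; first by rewrite expr0 divr1.
  have [_ le] := hP (r n); apply: le_trans le _.
  by rewrite exprSr invfM mulrA ler_wpM2r.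
pose c := 3 / 2 * (C + 1) * joint_norm s u.
have [n|l ul] := geometric_limit (x := fun n => u - r n) (c := c).
  rewrite /= !opprB addrC addrA subrK addrC subrK.
  have [le _] := hP (r n); apply: le_trans le _.
  have C1 : 0 <= C + 1 by lra.
  apply: le_trans (ler_wpM2l C1 (jr n)) _.
  rewrite le_eqVlt; apply/orP; left; apply/eqP; rewrite /c exprS; field.
  by rewrite expf_neq0.
suff uE : u = l by have := ul 0%N; rewrite -uE /= subrr subr0 expr0 divr1.
apply/eqP; rewrite -subr_eq0; apply/eqP/joint_norm_eq0/le_anti.
rewrite j0 andbT; pose M := \sum_(t <- s) opnorm t.
apply: (@le0_geometric _ _ (joint_norm s u + M * c)) => n.
have sj := joint_norm_seminorm s.
have -> : u - l = r n + -1 *: (l - (u - r n)).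
  by rewrite scaleN1r opprB addrA [r n + (u - r n)]addrC subrK.
apply: le_trans (sj.1 _ _) _; rewrite (seminormZ _ _ sj) normcN normc1 mul1r.
rewrite mulrDl lerD// (le_trans (joint_norm_le _ _))// -mulrA ler_wpM2l//.
by rewrite sumr_ge0// => *; exact: opnorm_ge0.
Qed.

Lemma finitely_generated_rank_one (g : dual E) (y : E) : L (rank_one g y).
Proof.
have [c c0 cP] := joint_norm_bounded_below.
apply: (dominated_rank_one _ (m := opnorm g * c)) => [|u].
  by rewrite mulr_ge0 ?opnorm_ge0.
by rewrite -mulrA (le_trans (opnorm_bound g u))// ler_wpM2l ?opnorm_ge0.
Qed.

End FinitelyGenerated.

Theorem theorem1p3 (R : realType) (E : completeNormedModType R[i])
    (L : set (boundedOp E E)) :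
  (exists x : E, x != 0) ->
  left_ideal L -> closed L ->
  reflexive_space E \/ fg_left_ideal L ->
  exactly_one
    (exists2 M : set (boundedOp E E), fixed_maximal_left_ideal M & L `<=` M)
    (finite_rank `<=` L).
Proof.
move=> _ lL cL reflfg; split; last first.
  move=> [[_ [x x0 ->] LM] FL]; have [f fx] := norming_vector x.
  have fx0 : f x != 0.
    by rewrite fx; apply: contra_neq x0 => /complexI; exact: rnorm0_eq0.
  have /eqP : rank_one f x x = 0 by apply/LM/FL/finite_rank_rank_one/fx0.
  by rewrite /= scaler_eq0 (negbTE fx0) (negbTE x0).
have [fixed|nfixed] := pselect (exists2 M : set (boundedOp E E),
  fixed_maximal_left_ideal M & L `<=` M); first by left.
right.
have sepL x : (forall T, L T -> T x = 0) -> x = 0.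
  move=> Lx; apply/eqP; apply: contrapT => /negP x0; apply: nfixed.
  by exists (fixed_left_ideal x) => //; exists x.
have [L0 LD _] := lL; apply: finite_rank_sub => //.
case: reflfg => [refl|[G [finG _ LG]]]; first exact: reflexive_rank_one.
pose s : seq (boundedOp E E) := finmap.enum_fset (fset_set G).
have sG t : (t \in s) = (t \in G) by rewrite -in_fset_set.
have sL t : t \in s -> L t.
  by rewrite sG inE LG => Gt; exact: sub_gen_smallest.
have s_uniq : uniq s by exact: finmap.fset_uniq.
apply: (finitely_generated_rank_one lL s_uniq sL) => // T; rewrite LG.
by apply: generated_dominated => t Gt; rewrite sG inE.
Qed.
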